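(* Let $n \geq 2$ and $1 \leq k < m + 1$ be integers. Then there exist an integer $N \geq n$ and rational maps of degree $m$ from $\mathbb{C}^n$ to $\mathbb{C}^N$ that are $k$-fold sphere maps, but not $(k+1)$-fold sphere maps. In particular, these maps do not take all zero-centric spheres to zero-centric spheres.
   Context: $S^{2n-1}$ is the unit sphere in $\mathbb{C}^n$. A zero-centric sphere is a sphere $rS^{2n-1}$, $r>0$, centered at the origin. ''$f$ takes all zero-centric spheres to zero-centric spheres'' means that for every $r>0$ there is $R>0$ with $f(rS^{2n-1})\subset RS^{2N-1}$. Definition: a rational map $f \colon \mathbb{C}^n \dashrightarrow \mathbb{C}^N$ is a $k$-fold sphere map if there exist numbers $0 < r_1 < r_2 < \cdots < r_k < \infty$ and $0 < R_1 , R_2 , \ldots , R_k < \infty$ such that the pole set of $f$ misses $r_kS^{2n-1}$ (and therefore $r_jS^{2n-1}$ for all $j$) and $f(r_jS^{2n-1}) \subset R_jS^{2N-1}$ for all $j = 1,\ldots,k$. The degree of a rational map $f=\frac{p}{q}$ in lowest terms ($p\colon\mathbb{C}^n\to\mathbb{C}^N$ and $q\colon\mathbb{C}^n\to\mathbb{C}$ polynomial with no nonconstant common factor) is the maximum of $\deg p$ and $\deg q$. *)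

(* Defs.v *)
From mathcomp Require Export all_boot all_order all_algebra.
From mathcomp Require Export reals complex mpoly.
Set Implicit Arguments.
Unset Strict Implicit.
Unset Printing Implicit Defensive.
Import GRing.Theory Num.Theory.
Local Open Scope ring_scope.
Local Open Scope complex_scope.

(* A rational map C^n --> C^N, given by its representation p / q in lowest    *)
(* terms, which is unique up to a common nonzero scalar factor.               *)
Record ratmap (R : realType) (n N : nat) := RatMap {
  rm_num : 'I_N -> {mpoly R[i][n]};
  rm_den : {mpoly R[i][n]};
  rm_den_neq0 : rm_den != 0;
  (* msize is one plus the total degree, so the conclusion says d is constant *)
  rm_lowest : forall d : {mpoly R[i][n]},
    (exists q, rm_den = d * q) ->
    (forall j, exists p, rm_num j = d * p) ->
    (msize d <= 1)%N
}.

Definition rm_degree (R : realType) (n N : nat) (f : ratmap R n N) : nat :=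
  maxn (\max_(j < N) (msize (rm_num f j)).-1) (msize (rm_den f)).-1.

Definition pole (R : realType) (n N : nat) (f : ratmap R n N) :
    {pred 'rV[R[i]]_n} :=
  [pred z : 'rV[R[i]]_n | (rm_den f).@[z 0] == 0].

(* Meaningful only off the pole set. *)
Definition rm_eval (R : realType) (n N : nat) (f : ratmap R n N)
    (z : 'rV[R[i]]_n) : 'rV[R[i]]_N :=
  \row_j ((rm_num f j).@[z 0] / (rm_den f).@[z 0]).

(* The modulus `|z 0 i| lives in R[i], hence the embedding of r ^+ 2. *)
Definition sphere (R : realType) (n : nat) (r : R) : {pred 'rV[R[i]]_n} :=
  [pred z : 'rV[R[i]]_n | \sum_(i < n) `|z 0 i| ^+ 2 == (r ^+ 2)%:C].

(* f (r S) is included in s S; the image of a set under a rational map is the *)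
(* image of the part of it on which the map is defined.                       *)
Definition maps_sphere (R : realType) (n N : nat) (f : ratmap R n N)
    (r s : R) : Prop :=
  forall z : 'rV[R[i]]_n,
    z \in sphere r -> z \notin pole f -> rm_eval f z \in sphere s.

(* The radii r_1 < ... < r_k are indexed from 0; for k > 0 the index j with   *)
(* j.+1 = k is that of the outermost sphere.                               *)
Definition kfold_sphere_map (R : realType) (n N k : nat)
    (f : ratmap R n N) : Prop :=
  exists r s : 'I_k -> R,
    [/\ forall j, 0 < r j,
        forall i j : 'I_k, (i < j)%N -> r i < r j,
        forall j, 0 < s j,
        forall j : 'I_k, j.+1 = k ->
          forall z, z \in sphere (r j) -> z \notin pole f
      & forall j, maps_sphere f (r j) (s j)].

Definition maps_all_spheres (R : realType) (n N : nat)
    (f : ratmap R n N) : Prop :=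
  forall r : R, 0 < r -> exists2 s : R, 0 < s & maps_sphere f r s.

(* Main.v *)
(* With t = |z|^2, let P be monic of degree m with exactly k positive roots,   *)
(* let q = 1 + e z_0 with e > 0 small and G = B (1 + t + ... + t^(m-1)) with B *)
(* large. The real polynomial G(t) |q|^2 + P(t) is the squared norm of a       *)
(* polynomial map p of degree m, since it equals                               *)
(*   e G |1 + z_0|^2 + e (1 - e) G (t - |z_0|^2)                               *)
(*     + [(1 - e) G + P - e (1 - e) t G]                                       *)
(* and the bracket has positive coefficients in t. Hence                       *)
(* |p/q|^2 = G(t) + P(t) / |q|^2, which is constant on a sphere iff P(t) = 0,  *)
(* because |q| is not constant there. If p and q had a common factor, then p   *)
(* would vanish at the point (-1/e, 0, ..., 0), where |p|^2 = P(1/e^2) != 0.   *)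

Require Import Defs.
From mathcomp Require Import ring lra zify.
Set Implicit Arguments.
Unset Strict Implicit.
Unset Printing Implicit Defensive.
Import Order.TTheory GRing.Theory Num.Theory.
Local Open Scope ring_scope.
Local Open Scope complex_scope.

(** The map is designed through the squared norm of its numerator, [G * nsq q + P] in [t = norm2 z],
    where [P = nodes m s] vanishes at the squares of 1, ..., k. On the spheres of these radii the
    squared norm of [f] is G(t); on every other sphere it takes different values at r e_0 and r e_1.
    So exactly k zero-centric spheres go to zero-centric spheres.

    What remains is to realize this function as a squared norm of polynomials of degree exactly m.
    [sos] tracks such functions, [radial_pos] chooses B and e, [sos_nodes] assembles the squares,
    and [ratmap_nodes] turns them into a map in lowest terms. *)

Definition nsq (R : realType) (w : R[i]) : R :=
  complex.Re w ^+ 2 + complex.Im w ^+ 2.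

Lemma nsqE (R : realType) (w : R[i]) : (nsq w)%:C = `|w| ^+ 2.
Proof. exact: add_Re2_Im2. Qed.

Lemma nsqM (R : realType) (v w : R[i]) : nsq (v * w) = nsq v * nsq w.
Proof. by case: v w => [a b] [c d]; rewrite /nsq /=; ring. Qed.

Lemma nsq_ge0 (R : realType) (w : R[i]) : 0 <= nsq w.
Proof. by rewrite /nsq addr_ge0 ?sqr_ge0. Qed.

Lemma nsq_eq0 (R : realType) (w : R[i]) : (nsq w == 0) = (w == 0).
Proof.
by case: w => a b; rewrite /nsq /= paddr_eq0 ?sqr_ge0 // !sqrf_eq0 eq_complex.
Qed.

Lemma nsq_real (R : realType) (x : R) : nsq x%:C = x ^+ 2.
Proof. by rewrite /nsq /= expr0n addr0. Qed.

(** * Squared norms of polynomial maps *)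

Definition norm2 (R : realType) (n : nat) (z : 'rV[R[i]]_n) : R :=
  \sum_(i < n) nsq (z 0 i).

Lemma sphereE (R : realType) (n : nat) (r : R) (z : 'rV[R[i]]_n) :
  (z \in sphere r) = (norm2 z == r ^+ 2).
Proof.
rewrite inE -(inj_eq (@complexI R)) rmorph_sum /=; congr (_ == _).
by apply: eq_bigr => i _; rewrite nsqE.
Qed.

(* The degree d is exact: closure of [sos] under sums and products then also  *)
(* computes the degree of the final map.                                      *)
Definition sos (R : realType) (n d : nat) (F : 'rV[R[i]]_n -> R) : Prop :=
  exists2 s : seq {mpoly R[i][n]},
    \max_(p <- s) msize p = d.+1 & forall z, F z = \sum_(p <- s) nsq p.@[z 0].

Lemma sos_ext (R : realType) (n d : nat) (F G : 'rV[R[i]]_n -> R) :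
  F =1 G -> sos d F -> sos d G.
Proof. by move=> FG [s sd sF]; exists s => // z; rewrite -FG. Qed.

Lemma sos_nsq (R : realType) (n d : nat) (p : {mpoly R[i][n]}) :
  msize p = d.+1 -> sos d (fun z => nsq p.@[z 0]).
Proof. by move=> pd; exists [:: p]; rewrite ?big_seq1 // => z; rewrite big_seq1. Qed.

Lemma sosC (R : realType) (n : nat) (c : R) :
  0 < c -> sos 0 (fun _ : 'rV[R[i]]_n => c).
Proof.
move=> c0; apply: sos_ext (@sos_nsq R n 0 (Num.sqrt c)%:C%:MP _) => [z|].
  by rewrite mevalC nsq_real sqr_sqrtr ?ltW.
by rewrite msizeC (inj_eq (@complexI R) _ 0) sqrtr_eq0 -ltNge c0.
Qed.

Lemma sosD (R : realType) (n d e : nat) (F G : 'rV[R[i]]_n -> R) :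
  sos d F -> sos e G -> sos (maxn d e) (fun z => F z + G z).
Proof.
move=> [s sd sF] [t te tG]; exists (s ++ t) => [|z].
  by rewrite big_cat /= sd te maxnSS.
by rewrite big_cat sF tG.
Qed.

(** Squared moduli multiply, so the pairwise products of the two families serve (the tensor product
    of the maps). Two components of top degree have a product of degree exactly d + e, as
    polynomials form a domain. *)
Lemma sosM (R : realType) (n d e : nat) (F G : 'rV[R[i]]_n -> R) :
  sos d F -> sos e G -> sos (d + e) (fun z => F z * G z).
Proof.
move=> [s sd sF] [t te tG]; exists [seq p * q | p <- s, q <- t] => [|z]; last first.
  rewrite big_allpairs_dep sF tG mulr_suml; apply: eq_bigr => p _.
  by rewrite mulr_sumr; apply: eq_bigr => q _; rewrite mevalM nsqM.
have le_max (u : seq {mpoly R[i][n]}) a :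
    a \in u -> (msize a <= \max_(p <- u) msize p)%N.
  by move=> au; apply: leq_bigmax_seq.
have ex (u : seq {mpoly R[i][n]}) c : \max_(p <- u) msize p = c.+1 ->
    exists2 p, p \in u & msize p = c.+1.
  elim: u c => [|p u IH] c; first by rewrite big_nil.
  rewrite big_cons /maxn; case: ifP => _ => [/IH[q qu qc]|pc].
    by exists q => //; rewrite inE qu orbT.
  by exists p => //; rewrite mem_head.
have [p ps pd] := ex _ _ sd; have [q qt qe] := ex _ _ te.
apply/eqP; rewrite eqn_leq; apply/andP; split.
  apply/bigmax_leqP_seq => _ /allpairsP[[a b] [/= ain bin ->]] _.
  have [->|a0] := eqVneq a 0; first by rewrite mul0r msize0.
  have [->|b0] := eqVneq b 0; first by rewrite mulr0 msize0.
  move: (le_max _ _ ain) (le_max _ _ bin); rewrite msizeM // sd te.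
  by move: (msize a) (msize b) => x y; lia.
have -> : (d + e).+1 = msize (p * q).
  have nz (a : {mpoly R[i][n]}) c : msize a = c.+1 -> a != 0.
    by move=> ac; apply/eqP => a0; rewrite a0 msize0 in ac.
  by rewrite msizeM ?(nz _ _ pd) ?(nz _ _ qe) // pd qe addSn addnS.
by apply: le_max; apply/allpairsP; exists (p, q).
Qed.

Lemma sosX (R : realType) (n : nat) (i : 'I_n) :
  sos 1 (fun z : 'rV[R[i]]_n => nsq (z 0 i)).
Proof.
apply: sos_ext (@sos_nsq R n 1 'X_i _) => [z|]; first by rewrite mevalXU.
by rewrite msizeX mdeg1.
Qed.

Lemma sos_sumX (R : realType) (n l : nat) (u : 'I_l.+1 -> 'I_n) :
  sos 1 (fun z : 'rV[R[i]]_n => \sum_(j < l.+1) nsq (z 0 (u j))).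
Proof.
elim: l u => [|l IH] u.
  by apply: sos_ext (sosX R (u ord0)) => z; rewrite big_ord1.
have := sosD (sosX R (u ord0)) (IH (fun j => u (lift ord0 j))).
by apply: sos_ext => z; rewrite [RHS]big_ord_recl.
Qed.

Lemma sosXn (R : realType) (n j : nat) (F : 'rV[R[i]]_n -> R) :
  sos 1 F -> sos j (fun z => F z ^+ j).
Proof.
move=> sF; elim: j => [|j IH]; first exact: sosC ltr01.
by rewrite -add1n; apply: sos_ext (sosM sF IH) => z; rewrite exprS.
Qed.

Lemma sos_horner (R : realType) (n m : nat) (P : {poly R})
    (F : 'rV[R[i]]_n -> R) :
  size P = m.+1 -> (forall j, (j <= m)%N -> 0 < P`_j) -> sos 1 F ->
  sos m (fun z => P.[F z]).
Proof.
move=> Pm Ppos sF.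
suff: sos m (fun z => \sum_(j < m.+1) P`_j * F z ^+ j).
  by apply: sos_ext => z; rewrite horner_coef Pm.
elim: m Ppos {Pm} => [|m IH] Ppos.
  by apply: sos_ext (sosC n (Ppos 0 isT)) => z; rewrite big_ord1 expr0 mulr1.
have := sosD (IH (fun j jm => Ppos j (leqW jm)))
  (sosM (sosC n (Ppos m.+1 (leqnn _))) (sosXn m.+1 sF)).
rewrite add0n (maxn_idPr (leqnSn m)).
by apply: sos_ext => z; rewrite [RHS]big_ord_recr.
Qed.

(** * The choice of B and e *)

Definition geo (R : realType) (m : nat) : {poly R} := \poly_(j < m) 1.

Lemma geo_gt0 (R : realType) (m : nat) (t : R) :
  (0 < m)%N -> 0 < t -> 0 < (geo R m).[t].
Proof.
case: m => // m _ t0; rewrite horner_poly big_ord_recl mul1r expr0.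
by rewrite ltr_pwDl ?ltr01 // sumr_ge0 // => j _; rewrite mul1r exprn_ge0 ?ltW.
Qed.

(** What is left of G |q|^2 + P once the squares depending on more than t are split off. *)
Definition radial (R : realType) (B e : R) (m : nat) (P : {poly R}) : {poly R} :=
  ((1 - e) * B) *: geo R m + P - (e * (1 - e) * B) *: ('X * geo R m).

(** Two demands compete: B must outweigh the lower coefficients of P, while e B must stay small to
    keep the leading coefficient 1 - e (1 - e) B positive. So e is taken of order 1/B. *)
Lemma radial_pos (R : realType) (m : nat) (P : {poly R}) (K : R) :
  (0 < m)%N -> P \is monic -> size P = m.+1 ->
  exists B e : R,
    [/\ 0 < B, 0 < e < 1, e * K < 1, size (radial B e m P) = m.+1
      & forall j, (j <= m)%N -> 0 < (radial B e m P)`_j].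
Proof.
move=> m0 Pmon Pm.
have Plead : P`_m = 1 by rewrite -(monicP Pmon) lead_coefE Pm.
pose S := \sum_(j < m.+1) `|P`_j|.
have S0 : 0 <= S by apply: sumr_ge0.
have leS j : (j <= m)%N -> `|P`_j| <= S.
  rewrite -ltnS => jm; rewrite /S (bigD1 (Ordinal jm)) //= lerDl.
  exact: sumr_ge0.
have K0 : 0 <= `|K| by [].
(* Since e B = 1/2, the coefficients below degree m are at least B - 1 - S, and the leading one is 1
   - (1 - e)/2. The summand |K| gives e K <= 1/2. *)
pose B := 4 * (1 + S) + `|K|; pose e := (2 * B)^-1.
have B4 : 4 <= B by rewrite /B; lra.
have eB : e * B = 2^-1 by rewrite /e invfM -mulrA mulVf ?mulr1 // gt_eqF //; lra.
have e0 : 0 < e by rewrite /e invr_gt0; lra.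
have e8 : e <= 8^-1 by rewrite /e lef_pV2 ?posrE; lra.
have pos j : (j <= m)%N -> 0 < (radial B e m P)`_j.
  move=> jm; rewrite /radial coefB coefD !coefZ coefXM !coef_poly.
  have := leS j jm; rewrite ler_norml => /andP[PS _].
  have BS : 4 + 4 * S <= B by rewrite /B; lra.
  rewrite -mulrA [(1 - e) * B]mulrC (_ : e * _ = (1 - e) * (e * B)); last by ring.
  rewrite eB (_ : B * (1 - e) = B - e * B); last by ring.
  rewrite eB; case: (ltngtP j m) jm => // [jm|->] _.
    by case: j PS jm => [|j] PS jm /=; rewrite ?(ltnW jm); lra.
  by rewrite Plead; case: (m) m0 => //= m' _; rewrite leqnn; lra.
exists B, e; split=> //; first by lra.
- by apply/andP; split; lra.
- have : e * K <= e * B by rewrite ler_pM2l // /B; have := ler_norm K; lra.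
  by lra.
apply/eqP; rewrite eqn_leq; apply/andP; split; last first.
  rewrite ltnNge; apply/negP => /leq_sizeP/(_ m (leqnn m)) Lm.
  by have := pos m (leqnn m); rewrite Lm ltxx.
apply/leq_sizeP => j mj; rewrite /radial coefB coefD !coefZ coefXM !coef_poly.
rewrite ltnNge (ltnW mj) /= nth_default ?Pm // ifN; last by case: j mj.
by rewrite ltnNge -ltnS prednK ?mj ?(leq_trans _ mj) //= !mulr0 addr0 subr0.
Qed.

(* The power of 'X brings the degree up to m without adding a positive root. *)
Definition nodes (R : realType) (m : nat) (s : seq R) : {poly R} :=
  'X^(m - size s) * \prod_(x <- s) ('X - x%:P).

Lemma nodes_monic (R : realType) (m : nat) (s : seq R) : nodes m s \is monic.
Proof. by rewrite rpredM ?monicXn ?monic_prod_XsubC. Qed.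

Lemma size_nodes (R : realType) (m : nat) (s : seq R) :
  (size s <= m)%N -> size (nodes m s) = m.+1.
Proof.
move=> sm; rewrite size_monicM ?monicXn ?monic_neq0 ?monic_prod_XsubC //.
by rewrite size_polyXn size_prod_XsubC addSn addnS /= subnK.
Qed.

Lemma nodes_root (R : realType) (m : nat) (s : seq R) (t : R) :
  0 < t -> root (nodes m s) t = (t \in s).
Proof.
move=> t0; rewrite rootM root_prod_XsubC.
by rewrite /root hornerXn expf_eq0 gt_eqF // andbF.
Qed.

(** * Construction of the rational map *)

Lemma msize_affine (R : realType) (n : nat) (i : 'I_n) (c : R[i]) :
  c != 0 -> msize (1 + c *: 'X_i : {mpoly R[i][n]}) = 2.
Proof.
move=> c0; apply/eqP; rewrite eqn_leq; apply/andP; split.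
  apply: leq_trans (msizeD_le _ _) _.
  by rewrite msize1 msizeZ // msizeX mdeg1.
suff : U_(i)%MM \in msupp (1 + c *: 'X_i : {mpoly R[i][n]}).
  by move/msize_mdeg_lt; rewrite mdeg1.
rewrite mcoeff_msupp mcoeffD mcoeffZ mcoeffX eqxx mulr1 mcoeff1.
by rewrite mnm1_eq0 add0r.
Qed.

Lemma sos_nodes (R : realType) (n m : nat) (P : {poly R}) (B e : R) :
  (0 < m)%N -> 0 < B -> 0 < e < 1 -> size (radial B e m P) = m.+1 ->
  (forall j, (j <= m)%N -> 0 < (radial B e m P)`_j) ->
  sos m (fun z : 'rV[R[i]]_n.+2 =>
    (B *: geo R m).[norm2 z] * nsq (1 + e%:C * z 0 ord0) + P.[norm2 z]).
Proof.
case: m => // m _ B0 /andP[e0 e1] sL Lpos.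
have sN : sos 1 (@norm2 R n.+2) := sos_sumX R (fun i => i).
have sgeo : sos m (fun z : 'rV[R[i]]_n.+2 => (geo R m.+1).[norm2 z]).
  apply: sos_horner sN => [|j jm]; first by rewrite size_poly_eq ?oner_eq0.
  by rewrite coef_poly ltnS jm ltr01.
have sZ : sos 1 (fun z : 'rV[R[i]]_n.+2 => nsq (1 + z 0 ord0)).
  apply: sos_ext (@sos_nsq R n.+2 1 (1 + 1 *: 'X_ord0) _) => [z|].
    by rewrite mevalD meval1 mevalZ mevalXU mul1r.
  by rewrite msize_affine ?oner_eq0.
(* The three summands of the identity; t - |z_0|^2 is the sum over the coordinates [lift ord0 j]. *)
have := sosD (sosD (sosM (sosC _ (mulr_gt0 e0 B0)) (sosM sgeo sZ))
  (sosM (sosC _ (mulr_gt0 (mulr_gt0 e0 (_ : 0 < 1 - e)) B0))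
    (sosM sgeo (sos_sumX R (fun j : 'I_n.+1 => lift ord0 j)))))
  (sos_horner sL Lpos sN).
rewrite !add0n !addn1 !maxnn; move=> sT; apply: sos_ext (sT _) => [z|]; last first.
  by rewrite subr_gt0.
rewrite /radial !(hornerD, hornerN, hornerZ, hornerM, hornerX).
set g := (geo _ _).[_]; set p := P.[_].
have -> : norm2 z = nsq (z 0 ord0) + \sum_(j < n.+1) nsq (z 0 (lift ord0 j)).
  by rewrite /norm2 big_ord_recl.
move: (\sum_(j < _) _) => T; case: (z 0 ord0) => x y; rewrite /nsq /=.
ring.
Qed.

Lemma big_nth_pad (T U : Type) (x0 : T) (idx : U) (op : Monoid.law idx)
    (F : T -> U) (s : seq T) (l : nat) :
  F x0 = idx ->
  \big[op/idx]_(j < size s + l) F (nth x0 s j) = \big[op/idx]_(x <- s) F x.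
Proof.
move=> F0; rewrite big_split_ord /= [X in op _ X]big1 => [|j _].
  by rewrite Monoid.mulm1 (big_nth x0) big_mkord.
by rewrite nth_default ?leq_addr.
Qed.

Lemma norm2_axis (R : realType) (n : nat) (i : 'I_n) (c : R[i]) :
  norm2 (c *: delta_mx 0 i) = nsq c.
Proof.
rewrite /norm2 (bigD1 i) //= !mxE !eqxx mulr1 big1 ?addr0 // => j ji.
by rewrite !mxE (negPf ji) andbF mulr0 nsq_real expr0n.
Qed.

(** K bounds the radii of the nodes, and [e * K < 1] keeps the pole hyperplane z_0 = -1/e outside
    the closed ball of radius K. *)
Lemma ratmap_nodes (R : realType) (n m : nat) (s : seq R) (K : R) :
  (0 < m)%N -> (size s <= m)%N -> 0 <= K -> (forall x, x \in s -> x <= K ^+ 2) ->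
  exists N (f : ratmap R n.+2 N) (e : R) (G : {poly R}),
    [/\ (n.+2 <= N)%N /\ rm_degree f = m, 0 < e /\ e * K < 1,
        forall t, 0 < t -> 0 < G.[t],
        forall z : 'rV_n.+2, (rm_den f).@[z 0] = 1 + e%:C * z 0 ord0
      & forall z : 'rV_n.+2, \sum_(j < N) nsq (rm_num f j).@[z 0] =
          G.[norm2 z] * nsq (rm_den f).@[z 0] + (nodes m s).[norm2 z]].
Proof.
move=> m0 sm K0 sK.
have [B [e [B0 e01 eK sL Lpos]]] :=
  radial_pos K m0 (nodes_monic m s) (size_nodes sm).
have [t td tE] := sos_nodes n m0 B0 e01 sL Lpos.
have /andP[e0 e1] := e01.
have eC0 : e%:C != 0 :> R[i] by rewrite (inj_eq (@complexI R) _ 0) gt_eqF.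
pose q : {mpoly R[i][n.+2]} := 1 + e%:C *: 'X_ord0.
have q2 : msize q = 2 by apply: msize_affine.
have qE (z : 'rV[R[i]]_n.+2) : q.@[z 0] = 1 + e%:C * z 0 ord0.
  by rewrite mevalD meval1 mevalZ mevalXU.
have q0 : q != 0 by apply/eqP => q0; rewrite q0 msize0 in q2.
(* The added components are the default value 0 of [nth]: they ensure N >= n + 2 and change neither
   norm nor degree. *)
pose N := (size t + n.+2)%N.
have tN (z : 'rV[R[i]]_n.+2) : \sum_(j < N) nsq (t`_j).@[z 0] =
    (B *: geo R m).[norm2 z] * nsq q.@[z 0] + (nodes m s).[norm2 z].
  rewrite qE tE (big_nth_pad _ (F := fun p => nsq p.@[z 0])) //.
  by rewrite meval0 nsq_real expr0n.
have low d : (exists q', q = d * q') ->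
    (forall j : 'I_N, exists p, t`_j = d * p) -> (msize d <= 1)%N.
  case=> q' qdq' dt.
  have [d0 q'0] : d != 0 /\ q' != 0.
    by move: q0; rewrite qdq' mulf_eq0 negb_or => /andP.
  pose z : 'rV[R[i]]_n.+2 := (- e^-1)%:C *: delta_mx 0 ord0.
  have zN : norm2 z = e^-1 ^+ 2 by rewrite norm2_axis nsq_real sqrrN.
  have qz : q.@[z 0] = 0.
    by rewrite qE !mxE !eqxx mulr1 -rmorphM mulrN divff ?gt_eqF // rmorphN addrN.
  (* Otherwise all components vanish at this zero of q, so 1/e^2 is a node and 1/e <= K. *)
  have dz : d.@[z 0] != 0.
    apply/eqP => dz; have := tN z; rewrite qz big1 => [|j _]; last first.
      by have [p ->] := dt j; rewrite mevalM dz mul0r nsq_real expr0n.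
    rewrite [nsq 0]nsq_real expr0n mulr0 add0r => /esym/eqP; rewrite zN.
    rewrite -[_ == 0]/(root _ _) nodes_root ?exprn_gt0 ?invr_gt0 // => /sK.
    rewrite ler_pXn2r ?nnegrE ?invr_ge0 ?(ltW e0) // leNgt.
    by rewrite -[X in _ < X]mul1r ltr_pdivlMr // mulrC eK.
  (* Hence q' vanishes at z, is nonconstant, and takes up the whole degree 1 of q. *)
  move: qz; rewrite qdq' mevalM => /eqP; rewrite mulf_eq0 (negPf dz) /= => q'z.
  move: q2; rewrite qdq' msizeM //.
  have : (1 < msize q')%N.
    rewrite ltnNge; apply/negP => /msize1_polyC q'c.
    move: q'z q'0; rewrite q'c mevalC => /eqP ->.
    by rewrite mpolyC0 eqxx.
  by move: (msize d) (msize q') => a b; lia.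
exists N, (RatMap q0 low), e, (B *: geo R m); split=> //.
- split; first exact: leq_addl.
  rewrite /rm_degree /= q2.
  rewrite (big_nth_pad _ (F := fun p => (msize p).-1)) ?msize0 //.
  rewrite -(big_morph predn (id1 := 0%N) (id2 := 0%N) (op1 := maxn) (op2 := maxn)) // => [|a b].
    by rewrite td /=; apply/maxn_idPl.
  by rewrite /=; lia.
- by move=> x x0; rewrite hornerZ mulr_gt0 // geo_gt0.
Qed.

(** * Which spheres go to spheres *)

Lemma norm2_rm_eval (R : realType) (n N : nat) (f : ratmap R n N)
    (z : 'rV[R[i]]_n) :
  z \notin pole f ->
  norm2 (rm_eval f z) * nsq (rm_den f).@[z 0] =
    \sum_(j < N) nsq (rm_num f j).@[z 0].
Proof.
rewrite inE => q0; rewrite mulr_suml; apply: eq_bigr => j _.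
by rewrite mxE -nsqM divfK.
Qed.

Theorem theorem3p14 (R : realType) (n k m : nat)
    (hn : (2 <= n)%N) (hk : (1 <= k)%N) (hkm : (k < m + 1)%N) :
  exists (N : nat) (f : ratmap R n N),
    [/\ (n <= N)%N,
        rm_degree f = m,
        kfold_sphere_map k f,
        ~ kfold_sphere_map k.+1 f
      & ~ maps_all_spheres f].
Proof.
case: n hn => [|[|n]] // _.
rewrite addn1 ltnS in hkm.
pose s : seq R := [seq j.+1%:R ^+ 2 | j <- iota 0 k].
have ss : size s = k by rewrite size_map size_iota.
have sK x : x \in s -> x <= k%:R ^+ 2.
  case/mapP => j; rewrite mem_iota => /andP[_ jk] ->.
  by rewrite ler_pXn2r ?nnegrE ?ler0n // ler_nat.
have sm : (size s <= m)%N by rewrite ss.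
have [N [f [e [G [[nN fm] [e0 eK] Gpos qE fE]]]]] :=
  ratmap_nodes n (leq_trans hk hkm) sm (ler0n R k) sK.
have on_sphere r t (z : 'rV_n.+2) : z \in sphere r -> z \notin pole f ->
    (rm_eval f z \in sphere t) = (G.[r ^+ 2] * nsq (rm_den f).@[z 0] +
      (nodes m s).[r ^+ 2] == t ^+ 2 * nsq (rm_den f).@[z 0]).
  rewrite !sphereE => /eqP zr zf; rewrite -zr -fE -norm2_rm_eval //.
  by rewrite (inj_eq (mulIf _)) // nsq_eq0; rewrite inE in zf.
have nodeP r t : 0 < r -> maps_sphere f r t -> r ^+ 2 \in s.
  move=> r0 frt; rewrite -(nodes_root m) ?exprn_gt0 //.
  (* Evaluation at r e_i, where q is 1 + e r for i = 0 and 1 otherwise. Both values are positive, so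
     these points are not poles even if the sphere meets the pole set. *)
  have val (i : 'I_n.+2) : (nodes m s).[r ^+ 2] =
      (t ^+ 2 - G.[r ^+ 2]) * (1 + e * (r *+ (i == ord0))) ^+ 2.
    set c := 1 + _; pose z : 'rV[R[i]]_n.+2 := r%:C *: delta_mx 0 i.
    have zr : z \in sphere r by rewrite sphereE norm2_axis nsq_real.
    have qz : (rm_den f).@[z 0] = c%:C.
      rewrite qE !mxE eqxx /= eq_sym /c; case: (i == ord0).
        by rewrite mulr1 rmorphD rmorphM.
      by rewrite mulr0n !mulr0 !addr0.
    have c0 : 0 < c.
      by rewrite /c ltr_pwDl ?ltr01 // mulr_ge0 ?mulrn_wge0 // ltW.
    have zf : z \notin pole f.
      by rewrite inE qz (inj_eq (@complexI R) _ 0) gt_eqF.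
    have := frt z zr zf; rewrite (on_sphere r) // qz nsq_real => /eqP.
    by rewrite mulrBl => <-; rewrite addrAC subrr add0r.
  have er := mulr_gt0 e0 r0.
  (* The point r e_1 gives P = t^2 - G, so r e_0 gives P = P (1 + e r)^2, which forces P = 0. *)
  have := val ord0; have := val (lift ord0 ord0).
  rewrite eqxx mulr1n mulr0n mulr0 addr0 expr1n mulr1 => <- Pr.
  apply: contraTT er => Pr0; rewrite -leNgt.
  have /(mulfI Pr0) : (nodes m s).[r ^+ 2] * 1 =
    (nodes m s).[r ^+ 2] * (1 + e * r) ^+ 2 by rewrite mulr1.
  nra.
exists N, f; split=> //.
- exists (fun j : 'I_k => j.+1%:R), (fun j : 'I_k => Num.sqrt G.[j.+1%:R ^+ 2]).
  split.
  + by move=> j; rewrite ltr0n.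
  + by move=> i j ij; rewrite ltr_nat.
  + by move=> j; rewrite sqrtr_gt0 Gpos // exprn_gt0 ?ltr0n.
  + move=> j jk z; rewrite sphereE jk => /eqP zk; rewrite inE qE.
    (* A pole has e |z_0| = 1, whereas e |z_0| <= e k < 1 on the outermost sphere. *)
    apply/eqP => q0; suff : e ^+ 2 * nsq (z 0 ord0) < 1.
      rewrite -nsq_real -nsqM (_ : e%:C * _ = (- 1)%:C).
        by rewrite nsq_real sqrrN expr1n ltxx.
      by apply/eqP; rewrite rmorphN rmorph1 -addr_eq0 addrC q0.
    apply: le_lt_trans (_ : (e * k%:R) ^+ 2 < 1).
      rewrite exprMn ler_wpM2l ?sqr_ge0 // -zk /norm2 (bigD1 ord0) //= lerDl.
      by apply: sumr_ge0 => l _; apply: nsq_ge0.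
    by rewrite expr_lt1 ?eK ?mulr_ge0 ?ler0n ?(ltW e0).
  move=> j z zj zf; rewrite (on_sphere _ _ _ zj zf).
  have /eqP -> : root (nodes m s) (j.+1%:R ^+ 2).
    rewrite nodes_root ?exprn_gt0 ?ltr0n //.
    by apply/mapP; exists (val j) => //; rewrite mem_iota ltn_ord.
  by rewrite addr0 sqr_sqrtr // ltW // Gpos // exprn_gt0 ?ltr0n.
- case=> r [t [r0 rinc _ _ frt]].
  (* Pigeonhole: k + 1 distinct squared radii would all lie among the k nodes. *)
  have : (size [seq r j ^+ 2 | j : 'I_k.+1] <= size s)%N.
    apply: uniq_leq_size.
      rewrite map_inj_uniq ?enum_uniq // => i j /eqP.
      rewrite eqrXn2 ?ltW // => /eqP rij; apply/val_inj.
      by case: (ltngtP i j) => // /rinc; rewrite rij ltxx.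
    by move=> _ /mapP[j _ ->]; apply: nodeP (frt j).
  by rewrite size_map -cardE card_ord ss ltnn.
move/(_ k.+1%:R (ltr0Sn _ _)) => [t _ /(nodeP _ _ (ltr0Sn _ _)) /sK].
by rewrite ler_pXn2r ?nnegrE ?ler0n // ler_nat ltnn.
Qed.
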